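(* Let $1\le i<j\le m$. For all sufficiently large positive integers $q$, the number $|M((\mathcal{B}_m^{\{x_i-x_j=0\}})_q)|$ of points $(x_1,\dots,x_m)\in\mathbb{Z}_q^m$ with $x_i=x_j$ that lie on no hyperplane $H'_q$ with $H'\in\mathcal{B}_m\setminus\{\{x_i-x_j=0\}\}$ equals $$\begin{cases}(q-2m+1)^{j-i-1}(q-2m+2)^{m-j}\big((q-2m+2)^i-(q-2m+1)^{i-1}\big) & \text{if } q \text{ is odd},\\ (q-2m+1)^{j-i-1}(q-2m+2)^{i-1}\big((q-2m+2)^{m-j+1}-(q-2m+1)^{m-j}\big) & \text{if } q \text{ is even}.\end{cases}$$
   Context: For $m\ge1$, the Shi arrangement of type B is the set of affine hyperplanes in $\mathbb{R}^m$ $$\mathcal{B}_m=\{\{x_s=0\},\{x_s=1\}\mid s\in[m]\}\cup\{\{x_s\pm x_t=0\},\{x_s\pm x_t=1\}\mid 1\le s<t\le m\},$$ where $[m]=\{1,\dots,m\}$. For a positive integer $q$ and a hyperplane $H=\{a_1x_1+\dots+a_mx_m=b\}$ with integer coefficients, $H_q=\{x\in\mathbb{Z}_q^m : [a_1]_qx_1+\dots+[a_m]_qx_m=[b]_q\}$ is its reduction modulo $q$, with $\mathbb{Z}_q=\mathbb{Z}/q\mathbb{Z}$. For $H\in\mathcal{B}_m$, the restriction is $\mathcal{B}_m^H=\{H\cap H' : H'\in\mathcal{B}_m\setminus\{H\},\ H\cap H'\neq\emptyset\}$, and $|M((\mathcal{B}_m^H)_q)|$ denotes the number of points of $H_q$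 not lying on any $H'_q$ with $H'\in\mathcal{B}_m\setminus\{H\}$ (the characteristic quasi-polynomial of the restriction). *)

(* Defs.v *)
From mathcomp Require Import all_boot all_order all_algebra.

Set Implicit Arguments.
Unset Strict Implicit.
Unset Printing Implicit Defensive.

Import GRing.Theory.
Local Open Scope ring_scope.

(* The pair (a, b) stands for {a_1 x_1 + ... + a_m x_m = b}.  The reduction
   modulo q depends on the integer equation, not only on the real point set,
   so the equation itself is the data. *)
Definition hyperplane (m : nat) : Type := ('rV[int]_m * int)%type.

Definition coord_form (m : nat) (s : 'I_m) : 'rV[int]_m := delta_mx 0 s.

(* {x_s - x_t = 0} *)
Definition diff_hyperplane (m : nat) (s t : 'I_m) : hyperplane m :=
  (coord_form s - coord_form t, 0).

(* The equations listed for distinct (s, b), resp. (s < t, sign, b), are never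
   proportional over the reals: equality of pairs is equality of hyperplanes. *)
Definition shi_B (m : nat) : seq (hyperplane m) :=
  [seq (coord_form s, b) | s <- enum 'I_m, b <- [:: 0; 1]] ++
  flatten [seq [:: (coord_form p.1 + coord_form p.2, 0);
                   (coord_form p.1 + coord_form p.2, 1);
                   diff_hyperplane p.1 p.2;
                   (coord_form p.1 - coord_form p.2, 1)]
          | p : 'I_m * 'I_m <- enum {: 'I_m * 'I_m} & (p.1 < p.2)%N].

(* The point set H_q.  'Z_q is Z/qZ only for 1 < q. *)
Definition hyperplane_mod (m q : nat) (H : hyperplane m) : {set 'rV['Z_q]_m} :=
  [set x : 'rV['Z_q]_m | \sum_(s < m) (H.1 0 s)%:~R * x 0 s == H.2%:~R].

(* M((A^H)_q).  A hyperplane H' with H :&: H' empty over the reals may be kept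
   here: in shi_B these are the parallels of H, with constant terms 0 and 1, so
   H_q and H'_q are disjoint for 1 < q. *)
Definition restriction_compl (m q : nat) (A : seq (hyperplane m))
    (H : hyperplane m) : {set 'rV['Z_q]_m} :=
  [set x in hyperplane_mod q H |
    all (fun H' => (H' != H) ==> (x \notin hyperplane_mod q H')) A].

(* Main.v *)
Require Import Defs.
From mathcomp Require Import all_boot all_order all_algebra.
From mathcomp Require Import zify ring.
From Stdlib Require Import FunctionalExtensionality.

(* After merging the equal coordinates, n = m - 1 labels remain.  Folding Z_q by
   x -> -x puts each of them, with a sign, on its own place among 1, .., q/2, and
   the Shi conditions say that neighbouring labels are increasing for a transitive
   relation; hence every run of consecutive occupied places is sorted and is
   determined by its set of signed labels.  So a point amounts to a free choice,
   for each label, of a sign and of the number of free places below it.  The runs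
   touching 0 or q/2 lose one sign, which leaves q - 2m + 2 options.  A label
   strictly between i and j must avoid the option of the merged label, and the
   conditions on 2 x_i forbid the merged label to come last in the last run: the
   choices where it would do so are the subtracted term. *)

Set Implicit Arguments.
Unset Strict Implicit.
Unset Printing Implicit Defensive.

(** * Runs of occupied places *)

Lemma card_window (T : finType) (p : T -> nat) (lo hi : nat) :
  injective p -> (#|[pred c | lo <= p c < hi]| <= hi - lo)%N.
Proof.
move=> injp; rewrite cardE -(size_map p) -(size_iota lo (hi - lo)).
apply: uniq_leq_size; first by rewrite map_inj_uniq ?enum_uniq.
by move=> u /mapP[c]; rewrite mem_enum inE mem_iota => + ->; lia.
Qed.

Lemma window_full (T : finType) (p : T -> nat) (lo hi u : nat) :
  injective p -> (hi - lo <= #|[pred c | lo <= p c < hi]|)%N ->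
  (lo <= u < hi)%N -> exists c, p c = u.
Proof.
move=> injp full u_in; pose s := map p (enum [pred c | lo <= p c < hi]%N).
have us : uniq s by rewrite map_inj_uniq ?enum_uniq.
have sub : {subset s <= iota lo (hi - lo)}.
  by move=> w /mapP[c]; rewrite mem_enum inE mem_iota => + ->; lia.
have [|_ eqs] := uniq_min_size us sub; first by rewrite size_iota size_map -cardE.
have : u \in s by rewrite eqs mem_iota; lia.
by case/mapP=> c _ ->; exists c.
Qed.

Lemma window_split (T : finType) (p : T -> nat) (lo mid hi : nat) :
  (lo <= mid <= hi)%N ->
  #|[pred c | lo <= p c < hi]%N| =
  (#|[pred c | lo <= p c < mid]%N| + #|[pred c | mid <= p c < hi]%N|)%N.
Proof.
move=> h; rewrite -cardUI [X in (_ = _ + X)%N]eq_card0 ?addn0.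
  by apply: eq_card => c; rewrite !inE; lia.
by move=> c; rewrite !inE; lia.
Qed.

(** Induction on the distance: the label on the place just below [c] extends the chain by one
    step. *)
Lemma full_run_trans (T : Type) (p : T -> nat) (R : rel T) (a c : T) :
  transitive R -> (forall u v, p v = (p u).+1 -> R u v) ->
  (p a < p c)%N -> (forall u, (p a <= u < p c)%N -> exists e, p e = u) -> R a c.
Proof.
move=> trR succR; move d : (p c - p a).-1 => d'.
elim: d' c d => [|d IH] c dE lt_ac full; first by apply: succR; lia.
have [|e pe] := full (p a + d.+1)%N; first by lia.
apply: (trR e); last by apply: succR; lia.
by apply: IH => [||u hu]; [lia | lia | apply: full; lia].
Qed.

(* Number of free positions below the one of [a]. *)
Definition block (T : finType) (p : T -> nat) (a : T) : nat :=
  (p a - #|[pred c | p c < p a]%N|)%N.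

(** Inverse of [block]: free places below plus labels below, the labels being ordered
    lexicographically by [b] and then by [lt]. *)
Definition block_pos (T : finType) (b : T -> nat) (lt : rel T) (a : T) : nat :=
  (b a + #|[pred c | (b c < b a) || (b c == b a) && lt c a]%N|)%N.

Lemma card_below (T : finType) (p : T -> nat) (a : T) :
  #|[pred c | p c < p a]%N| = #|[pred c | 0 <= p c < p a]%N|.
Proof. by apply: eq_card. Qed.

Lemma card_below_le (T : finType) (p : T -> nat) (a : T) :
  injective p -> (#|[pred c | p c < p a]%N| <= p a)%N.
Proof. by move=> /card_window h; rewrite card_below; have := h 0%N (p a); lia. Qed.

Lemma blockE (T : finType) (p : T -> nat) (a : T) : injective p ->
  p a = (block p a + #|[pred c | p c < p a]%N|)%N.
Proof. by move=> /card_below_le - /(_ a); rewrite /block; lia. Qed.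

Lemma block_le (T : finType) (p : T -> nat) (a c : T) : injective p ->
  (p a <= p c)%N -> (block p a <= block p c)%N.
Proof.
move=> injp le_ac; have := blockE a injp; have := blockE c injp.
rewrite !card_below (window_split (mid := p a) p (lo := 0) (hi := p c)) //.
by have := card_window (p a) (p c) injp; lia.
Qed.

(** Equal blocks mean that no free place lies between, so the window is filled by pigeonhole. *)
Lemma block_eq_full (T : finType) (p : T -> nat) (a c : T) (u : nat) :
  injective p -> block p a = block p c ->
  (p a <= u < p c)%N -> exists e, p e = u.
Proof.
move=> injp eq_ac hu; apply: (window_full injp _ hu).
have := blockE a injp; have := blockE c injp.
by rewrite !card_below (window_split (mid := p a) p (lo := 0) (hi := p c)); lia.
Qed.

Lemma block0_full (T : finType) (p : T -> nat) (a : T) (u : nat) :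
  injective p -> block p a = 0%N -> (u < p a)%N -> exists e, p e = u.
Proof.
move=> injp ba0 hu; apply: (window_full (lo := 0) (hi := p a) injp) => //.
by rewrite -card_below; have := blockE a injp; lia.
Qed.

Lemma card_above (T : finType) (p : T -> nat) (r : nat) (a : T) :
  (forall c, p c < r)%N ->
  #|T| = (#|[pred c | p c < p a]%N| + #|[pred c | p a <= p c < r]%N|)%N.
Proof.
move=> ltpr; rewrite card_below -window_split; last by have := ltpr a; lia.
by apply: eq_card => c; rewrite !inE ltpr.
Qed.

Lemma block_bound (T : finType) (p : T -> nat) (r : nat) (a : T) :
  injective p -> (forall c, p c < r)%N -> (block p a <= r - #|T|)%N.
Proof.
move=> injp ltpr; have := card_above a ltpr; have := blockE a injp.
by have := card_window (p a) r injp; have := ltpr a; lia.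
Qed.

Lemma block_last_full (T : finType) (p : T -> nat) (r : nat) (a : T) (u : nat) :
  injective p -> (forall c, p c < r)%N -> (#|T| <= r)%N ->
  block p a = (r - #|T|)%N -> (p a <= u < r)%N -> exists e, p e = u.
Proof.
move=> injp ltpr ler ba hu; apply: (window_full injp _ hu).
by have := card_above a ltpr; have := blockE a injp; lia.
Qed.

Lemma block_eq_rel (T : finType) (p : T -> nat) (R : rel T) (a c : T) :
  injective p -> transitive R -> (forall u v, p v = (p u).+1 -> R u v) ->
  (p a < p c)%N -> block p a = block p c -> R a c.
Proof.
move=> injp trR succR lt_ac eq_ac.
by apply: (full_run_trans trR succR lt_ac) => u; apply: block_eq_full.
Qed.

(** Labels of one block fill a run of consecutive places, along which [succR] and transitivity give
    [R], hence [lt]. So the lexicographic order used by [block_pos] is the order of the places. *)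
Lemma blockK (T : finType) (p : T -> nat) (R lt : rel T) (a : T) :
  injective p -> transitive R -> (forall u v, p v = (p u).+1 -> R u v) ->
  subrel R lt -> (forall u v, lt u v -> ~~ lt v u) -> 
  block_pos (block p) lt a = p a.
Proof.
move=> injp trR succR subR asym; rewrite [RHS](blockE a injp); congr addn.
apply: eq_card => c; rewrite !inE.
have relE u v := @block_eq_rel T p R u v injp trR succR.
case: (ltngtP (p c) (p a)) => [lt_ca|lt_ac|/injp ->].
- have := block_le injp (ltnW lt_ca); rewrite leq_eqVlt orbC => /orP[-> //|/eqP e].
  by rewrite e eqxx (subR _ _ (relE _ _ lt_ca e)) orbT.
- have := block_le injp (ltnW lt_ac); case: ltngtP => //= e _.
  by apply/negbTE/asym/subR/relE.
- by rewrite ltnn eqxx; apply/negbTE/negP => /= h; have := asym _ _ h; rewrite h.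
Qed.

(** The differences count lexicographic predecessors; those of [a] are also those of [c], and [a]
    itself is a further one. *)
Lemma block_pos_lt (T : finType) (b : T -> nat) (lt : rel T) (a c : T) :
  transitive lt -> irreflexive lt ->
  ((b a < b c) || (b a == b c) && lt a c)%N ->
  (block_pos b lt a - b a < block_pos b lt c - b c)%N.
Proof.
move=> tr irr h; rewrite /block_pos !addKn; apply/proper_card/properP; split.
  apply/subsetP=> e; rewrite !inE.
  case/orP: h => [h|/andP[/eqP -> h]] /orP[h'|/andP[/eqP -> h']].
  - by rewrite (ltn_trans h' h).
  - by rewrite h.
  - by rewrite h'.
  - by rewrite eqxx (tr a) ?orbT.
by exists a; rewrite !inE // ltnn irr andbF.
Qed.

Lemma block_pos_ltE (T : finType) (b : T -> nat) (lt : rel T) (a c : T) :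
  transitive lt -> irreflexive lt -> (forall u v, u != v -> lt u v || lt v u) ->
  (block_pos b lt a < block_pos b lt c)%N =
  ((b a < b c) || (b a == b c) && lt a c)%N.
Proof.
move=> tr irr tot.
have mono u v : ((b u < b v) || (b u == b v) && lt u v)%N ->
    (block_pos b lt u < block_pos b lt v)%N.
  move=> h; have := block_pos_lt tr irr h.
  have : (b u <= b v)%N by case/orP: h => [/ltnW //|/andP[/eqP -> _]].
  by rewrite /block_pos; lia.
apply/idP/idP => [lt_ac|]; last exact: mono.
have [e|ne_ac] := eqVneq a c; first by rewrite e ltnn in lt_ac.
have := mono c a; case: (ltngtP (b a) (b c)) => //= e; first by move/(_ isT); lia.
by have := tot _ _ ne_ac; case: (lt a c) => //= -> /(_ isT); lia.
Qed.

Lemma block_pos_inj (T : finType) (b : T -> nat) (lt : rel T) :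
  transitive lt -> irreflexive lt -> (forall u v, u != v -> lt u v || lt v u) ->
  injective (block_pos b lt).
Proof.
move=> tr irr tot a c e; apply/eqP/negPn/negP => ne.
have := block_pos_ltE b a c tr irr tot; have := block_pos_ltE b c a tr irr tot.
by rewrite e !ltnn; have := tot _ _ ne; case: ltngtP => //= _; case: (lt a c) => //= ->.
Qed.

Lemma block_posK (T : finType) (b : T -> nat) (lt : rel T) (a : T) :
  transitive lt -> irreflexive lt -> (forall u v, u != v -> lt u v || lt v u) ->
  block (block_pos b lt) a = b a.
Proof.
move=> tr irr tot; rewrite /block [X in (_ - X)%N](_ : _ = (block_pos b lt a - b a)%N).
  by rewrite /block_pos; lia.
rewrite {3}/block_pos addKn; apply: eq_card => c.
by rewrite !inE block_pos_ltE.
Qed.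

(** Passing to a later label adds at least one predecessor, which uses up the whole step and leaves
    [b] unchanged. *)
Lemma block_pos_succ (T : finType) (b : T -> nat) (lt : rel T) (a c : T) :
  transitive lt -> irreflexive lt -> (forall u v, u != v -> lt u v || lt v u) ->
  block_pos b lt c = (block_pos b lt a).+1 -> b a = b c /\ lt a c.
Proof.
move=> tr irr tot e.
have := block_pos_ltE b a c tr irr tot; rewrite e ltnSn => /esym h.
have := block_pos_lt tr irr h; move: e; rewrite /block_pos !addKn => e h2.
have e2 : b a = b c by case/orP: h => [h|/andP[/eqP -> _]] //; lia.
by split=> //; move: h; rewrite e2 ltnn eqxx.
Qed.

Lemma block_pos_bound (T : finType) (b : T -> nat) (lt : rel T) (a : T) :
  irreflexive lt -> (block_pos b lt a < b a + #|T|)%N.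
Proof.
move=> irr; rewrite /block_pos ltn_add2l; apply/proper_card/properP.
by split; [apply/subsetP | exists a; rewrite // inE ltnn irr andbF].
Qed.

Lemma block_pos_max (T : finType) (b : T -> nat) (lt : rel T) (E : nat) (a : T) :
  transitive lt -> irreflexive lt -> (forall u v, u != v -> lt u v || lt v u) ->
  (forall c, b c <= E)%N -> (block_pos b lt a).+1 = (E + #|T|)%N ->
  b a = E /\ forall c, b c = E -> ~~ lt a c.
Proof.
move=> tr irr tot leE e; have baE : b a = E.
  by have := block_pos_bound b a irr; have := leE a; lia.
split=> // c bc; apply/negP => lt_ac.
have := block_pos_ltE b a c tr irr tot; rewrite baE bc eqxx lt_ac orbT.
by have := block_pos_bound b c irr; lia.
Qed.

(** * Signed labels on the half circle *)

(* [sg a] means that label [a] sits at [- p] instead of [p].  On the half circle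
   a label [a] is read as [a] or [-a], and within a run of consecutive occupied
   places the labels follow the order 1 < .. < n < -n < .. < -1. *)
Definition signed_lt (n : nat) (sg : 'I_n -> bool) : rel 'I_n :=
  fun a c => if sg a then sg c && (c < a)%N else sg c || (a < c)%N.

(* [s] stands for the two merged coordinates with labels [s] and [t], and
   [s < a < t] can be neither below [s] nor above [t]. *)
Definition incomparable (n : nat) (s : 'I_n) (t : nat) (a c : 'I_n) : bool :=
  ((a == s) && (s < c < t) || (c == s) && (s < a < t))%N.

(** For opposite signs, adjacency restricts only the sum of the two values, so incomparability
    matters for equal signs only. *)
Definition run_rel (n : nat) (s : 'I_n) (t : nat) (sg : 'I_n -> bool) : rel 'I_n :=
  fun a c => signed_lt sg a c && ~~ ((sg a == sg c) && incomparable s t a c).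

(** Sums of two such values lie between 4 and 2q - 2, so the residues 0 and 1 are the sums [q] and
    [q.+1]. The doubled conditions come from the pair of merged coordinates, and the last clause
    from the difference of coordinate [a] and the larger merged one. *)
Definition admissible_values (q n : nat) (s : 'I_n) (t : nat) (v : 'I_n -> nat) : Prop :=
  [/\ forall a, (1 < v a < q)%N,
      forall a c : 'I_n, (a < c)%N ->
        v a <> v c /\ (v a + v c)%N <> q /\ (v a + v c)%N <> q.+1 /\ v a <> (v c).+1,
      (v s).*2 <> q, (v s).*2 <> q.+1 &
      forall a : 'I_n, (s < a < t)%N -> v a <> (v s).+1].

(* The place [k.+1] of the half circle is [p = k].  For even [q] the last place
   [q / 2] is its own opposite and is given the positive sign. *)
Definition admissible_positions (q n : nat) (s : 'I_n) (t : nat)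
    (sg : 'I_n -> bool) (p : 'I_n -> nat) : Prop :=
  [/\ forall a, (p a < q./2)%N, injective p,
      forall a c, p c = (p a).+1 -> run_rel s t sg a c,
      forall a, p a = 0%N -> sg a &
      if odd q then ~ (sg s /\ (p s).+1 = q./2)
      else (forall a, (p a).+1 = q./2 -> ~~ sg a) /\ (p s).+1 <> q./2].

(** [E] is the total number of free places, so a label of block [E] lies in the run that reaches the
    last place. The final clause keeps [s] from coming last there: for odd [q] the negative labels
    end the run in decreasing order, while for even [q] all are positive and those strictly between
    [s] and [t] are already excluded. *)
Definition admissible_blocks (odd_q : bool) (E n : nat) (s : 'I_n) (t : nat)
    (sg : 'I_n -> bool) (b : 'I_n -> nat) : Prop :=
  [/\ forall a, (b a <= E)%N,
      forall a, b a = 0%N -> sg a,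
      forall a : 'I_n, (s < a < t)%N -> sg a = sg s -> b a <> b s &
      if odd_q
      then ~ [/\ sg s, b s = E & forall a : 'I_n, (a < s)%N -> sg a -> b a <> E]
      else (forall a, b a = E -> ~~ sg a) /\
           ~ (b s = E /\ forall a : 'I_n, (t <= a)%N -> b a <> E)].

Lemma signed_lt_trans (n : nat) (sg : 'I_n -> bool) : transitive (signed_lt sg).
Proof.
by move=> c a e; rewrite /signed_lt; case: (sg a) (sg c) (sg e) => [] [] [] //=; lia.
Qed.

Lemma signed_lt_irr (n : nat) (sg : 'I_n -> bool) : irreflexive (signed_lt sg).
Proof. by move=> a; rewrite /signed_lt ltnn; case: (sg a). Qed.

Lemma signed_lt_total (n : nat) (sg : 'I_n -> bool) (a c : 'I_n) :
  a != c -> signed_lt sg a c || signed_lt sg c a.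
Proof.
by rewrite /signed_lt -val_eqE /=; case: (sg a) (sg c) => [] [] //=; lia.
Qed.

Lemma signed_lt_asym (n : nat) (sg : 'I_n -> bool) (a c : 'I_n) :
  signed_lt sg a c -> ~~ signed_lt sg c a.
Proof. by rewrite /signed_lt; case: (sg a) (sg c) => [] [] //=; lia. Qed.

(** Labels of equal sign form an interval for [signed_lt], so a label placed between [s] and an
    incomparable label of the same sign also lies strictly between [s] and [t], hence is itself
    incomparable with [s]. *)
Lemma run_rel_trans (n : nat) (s : 'I_n) (t : nat) (sg : 'I_n -> bool) :
  transitive (run_rel s t sg).
Proof.
move=> c a e; rewrite /run_rel /signed_lt /incomparable -!val_eqE /=.
by case: (sg a) (sg c) (sg e) => [] [] [] //=; lia.
Qed.

(** Equal values and sum [q] are shared places. On adjacent places, sum [q.+1] is a negative label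
    just below a positive one, and a difference of 1 fixes the order of equal signs. The value 1
    would be a positive label at [p = 0], and the conditions on [(v s).*2] concern the last
    place. *)
Lemma positions_of_values (q n : nat) (s : 'I_n) (t : nat) (v : 'I_n -> nat) :
  admissible_values q s t v ->
  admissible_positions q s t (fun a => (q < (v a).*2)%N)
    (fun a => (if (q < (v a).*2)%N then q - v a else v a).-1).
Proof.
case=> v_in v_ne sne0 sne1 v_btw.
have qE := odd_double_half q.
split=> [a|a c|a c|a|].
- by have := v_in a; case: ifP; lia.
- move=> e; apply/val_inj/eqP => /=; have va := v_in a; have vc := v_in c.
  by case: ltngtP => // /v_ne; move: e; case: ifP; case: ifP; lia.
- move=> e; have va := v_in a; have vc := v_in c; have vs := v_in s.
  rewrite /run_rel /signed_lt /incomparable /=.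
  have : val a <> val c.
    by move/val_inj => eac; move: e; rewrite eac; lia.
  have := @v_ne a c; have := @v_ne c a; have := v_btw a; have := v_btw c.
  have [eas|_] := eqVneq a s; have [ecs|_] := eqVneq c s; move: e; rewrite ?eas ?ecs ?eqxx /=;
    (do ?case: ifP => ?); lia.
- by have := v_in a; case: ifP; lia.
- have vs := v_in s; case: (odd q) qE => /= qE; first by case: ifP; lia.
  by split=> [a|]; [have := v_in a; case: ifP; lia | case: ifP; lia].
Qed.

Lemma values_of_positions (q n : nat) (s : 'I_n) (t : nat)
    (sg : 'I_n -> bool) (p : 'I_n -> nat) :
  admissible_positions q s t sg p ->
  admissible_values q s t (fun a => if sg a then q - (p a).+1 else (p a).+1)%N.
Proof.
case=> p_lt injp p_succ p0 p_last.
have qE := odd_double_half q.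
have noE a : ~~ odd q -> (p a).+1 = q./2 -> sg a = false.
  by case: (odd q) p_last => //= -[h _] _ /h/negbTE.
have p0' a : sg a = false -> p a <> 0%N by move=> h /p0; rewrite h.
split=> [a|a c lt_ac|||a s_a].
- by have := p_lt a; have := p0' a; have := noE a; case: (sg a); lia.
- have ne : p a <> p c by move/injp => e; rewrite e ltnn in lt_ac.
  have := p_succ a c; have := p_succ c a; have := noE a; have := noE c.
  have := p_lt a; have := p_lt c; have := p0' a; have := p0' c.
  rewrite /run_rel /signed_lt /=; case: (sg a) (sg c) => [] [] /=; lia.
- have := p_lt s; have := p0' s; have := noE s.
  by case: (odd q) p_last qE => [h|[_ h]] /=; case: (sg s) h; lia.
- have := p_lt s; have := p0' s; have := noE s.
  case: (odd q) p_last qE => [h|[_ h]] /=; last by case: (sg s); lia.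
  case sgs: (sg s) h => h; last by lia.
  by have : (p s).+1 <> q./2; [move=> e; apply: h | lia].
- have ne : p a <> p s by move/injp => e; move: s_a; rewrite e ltnn.
  have := p_succ a s; have := p_succ s a; have := noE a; have := noE s.
  have := p_lt a; have := p_lt s; have := p0' a; have := p0' s.
  have : ~~ odd q -> (p s).+1 <> q./2 by case: (odd q) p_last => //= -[].
  rewrite /run_rel /signed_lt /incomparable eqxx s_a /=.
  by case: (sg a) (sg s) => [] [] /=; rewrite ?eqxx ?orbT ?andbF /=; lia.
Qed.

Lemma positions_of_valuesK (q n : nat) (v : 'I_n -> nat) (a : 'I_n) :
  (1 < v a < q)%N ->
  (if (q < (v a).*2)%N then q - (if (q < (v a).*2)%N then q - v a else v a).-1.+1
   else (if (q < (v a).*2)%N then q - v a else v a).-1.+1)%N = v a.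
Proof. by move=> va; case: (ltnP q (v a).*2) => h /=; lia. Qed.

Lemma values_of_positionsK (q n : nat) (s : 'I_n) (t : nat)
    (sg : 'I_n -> bool) (p : 'I_n -> nat) (a : 'I_n) :
  admissible_positions q s t sg p ->
  let v := (if sg a then q - (p a).+1 else (p a).+1)%N in
  (q < v.*2)%N = sg a /\ (if sg a then q - v else v).-1 = p a.
Proof.
case=> p_lt _ _ _ p_last; have qE := odd_double_half q; have pa := p_lt a.
have noE : ~~ odd q -> (p a).+1 = q./2 -> sg a = false.
  by case: (odd q) p_last => //= -[h _] _ /h/negbTE.
by case: (sg a) noE => /=; lia.
Qed.

Lemma blocks_of_positions (q n : nat) (s : 'I_n) (t : nat)
    (sg : 'I_n -> bool) (p : 'I_n -> nat) :
  (n <= q./2)%N -> admissible_positions q s t sg p ->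
  admissible_blocks (odd q) (q./2 - n) s t sg (block p).
Proof.
move=> le_nq [p_lt injp p_succ p0 p_last]; rewrite -{1}(card_ord n) in le_nq.
have blk_rel a c : (p a < p c)%N -> block p a = block p c -> run_rel s t sg a c.
  exact: block_eq_rel injp (@run_rel_trans _ s t sg) p_succ.
(* A label of the last block is followed by occupied places only, so the label [e] on the last place
   is [a] or comes after it in the run. *)
have to_last a : block p a = (q./2 - n)%N -> exists e,
    (p e).+1 = q./2 /\ (e = a \/ block p e = (q./2 - n)%N /\ run_rel s t sg a e).
  move=> ba; have pa := p_lt a.
  have [||e pe] := @block_last_full _ p q./2 a (q./2).-1 injp p_lt le_nq.
  - by rewrite card_ord.
  - by lia.
  have [eea|ne] := eqVneq e a; first by exists e; split; [lia | left].
  exists e; split; first by lia.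
  have lt_ae : (p a < p e)%N.
    by have : p a <> p e; [move/injp/esym/eqP; rewrite (negbTE ne) | lia].
  have be : block p e = (q./2 - n)%N.
    have := block_bound e injp p_lt; have := block_le injp (ltnW lt_ae).
    by rewrite card_ord; lia.
  by right; split=> //; apply: blk_rel; rewrite ?ba.
split=> [a|a ba0|a s_a sg_as ba_bs|].
- by rewrite -[X in (_ - X)%N]card_ord; apply: block_bound.
- have [/p0 //|pa] := posnP (p a).
  (* The run reaches [p = 0], where the label is negative, and only negative labels follow a
     negative one. *)
  have [e pe] := block0_full injp ba0 pa.
  have be0 : block p e = 0%N by rewrite /block pe.
  have : run_rel s t sg e a by apply: blk_rel; rewrite ?pe ?be0.
  by rewrite /run_rel /signed_lt (p0 _ pe); case: (sg a).
- have ne : p a <> p s by move/injp => e; move: s_a; rewrite e ltnn.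
  case: (ltngtP (p a) (p s)) => // lt.
    have := blk_rel _ _ lt ba_bs.
    by rewrite /run_rel /incomparable sg_as eqxx s_a eqxx orbT andbF.
  have := blk_rel _ _ lt (esym ba_bs).
  by rewrite /run_rel /incomparable sg_as eqxx s_a eqxx andbF.
- case: (odd q) p_last => [h [sgs bs no]|[h1 h2]].
    have [e [pe [ees|[be]]]] := to_last _ bs; first by apply: h; rewrite -{2}ees.
    rewrite /run_rel /signed_lt sgs => /andP[/andP[sge lt_es] _].
    exact: (no e lt_es sge be).
  have pos a : block p a = (q./2 - n)%N -> ~~ sg a.
    move=> ba; have [e [/h1 sge [<- //|[_]]]] := to_last _ ba.
    by rewrite /run_rel /signed_lt (negbTE sge); case: (sg a).
  split=> // -[bs no].
  have [e [pe [ees|[be]]]] := to_last _ bs; first by apply: h2; rewrite -ees.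
  rewrite /run_rel /signed_lt /incomparable (negbTE (h1 _ pe)) (negbTE (pos _ bs)) !eqxx /=.
  (* The label on the last place is above [s] and comparable with it, hence at least [t]. *)
  by move=> hh; apply: (no e) => //; lia.
Qed.

(** Sorting by block and then by the total order [signed_lt] gives [run_rel] on neighbours: they
    share a block, where [b_btw] leaves no incomparable pair of equal sign. *)
Lemma positions_of_blocks (q n : nat) (s : 'I_n) (t : nat)
    (sg : 'I_n -> bool) (b : 'I_n -> nat) :
  (n < q./2)%N -> (s < t)%N -> admissible_blocks (odd q) (q./2 - n) s t sg b ->
  admissible_positions q s t sg (block_pos b (signed_lt sg)).
Proof.
move=> lt_nq lt_st [b_le b0 b_btw b_last].
have tr := @signed_lt_trans n sg; have irr := @signed_lt_irr n sg.
have tot := @signed_lt_total n sg.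
have last_max a : (block_pos b (signed_lt sg) a).+1 = q./2 ->
    b a = (q./2 - n)%N /\ forall c, b c = (q./2 - n)%N -> ~~ signed_lt sg a c.
  by move=> e; apply: (block_pos_max tr irr tot b_le); rewrite card_ord e; lia.
split=> [a||a c||].
- have := block_pos_bound b a irr; have := b_le a; rewrite card_ord; lia.
- exact: block_pos_inj.
- case/(block_pos_succ tr irr tot) => bac lt_ac; rewrite /run_rel lt_ac /=.
  apply/negP => /andP[/eqP sg_ac] /orP[/andP[/eqP ea h]|/andP[/eqP ec h]]; subst.
    by have := b_btw c h (esym sg_ac) (esym bac).
  by have := b_btw a h sg_ac bac.
- by move=> a; rewrite /block_pos => e; apply: b0; lia.
- case: (odd q) b_last => [h [sgs /last_max[bs mx]]|[h1 h2]]; last split.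
  + apply: h; split=> // a lt_as sga /mx.
    by rewrite /signed_lt sgs sga lt_as.
  + by move=> a /last_max[/h1].
  + move=> /last_max[bs mx]; apply: h2; split=> // a le_ta ba.
    by have := mx a ba; rewrite /signed_lt (negbTE (h1 _ bs)) (leq_trans lt_st le_ta) orbT.
Qed.

(** * Counting constrained choices *)

(** Once [z s] is fixed the other labels choose independently, with one option fewer on [K], so the
    set is a [family] and its size a product. *)
Lemma card_ffun_avoid (I U : finType) (opt : pred U) (s : I) (u : U) (K : pred I) :
  opt u -> ~~ K s ->
  #|[set z : {ffun I -> U} | [forall a, opt (z a)] && (z s == u) &&
       [forall a, K a ==> (z a != u)]]| =
  (#|opt|.-1 ^ #|K| * #|opt| ^ (#|I|.-1 - #|K|))%N.
Proof.
move=> opt_u Ks.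
pose F a := [pred w | opt w && ((a == s) ==> (w == u)) && (K a ==> (w != u))].
have -> : #|[set z : {ffun I -> U} | [forall a, opt (z a)] && (z s == u) &&
       [forall a, K a ==> (z a != u)]]| = #|family F|.
  apply: eq_card => z; rewrite !inE; apply/idP/familyP.
    case/andP=> /andP[/forallP h1 h2] /forallP h3 a; rewrite !inE h1 h3 andbT /=.
    by apply/implyP => /eqP ->.
  move=> h; rewrite -andbA; apply/and3P; split.
  - by apply/forallP => a; have /andP[/andP[]] := h a.
  - by have /andP[/andP[_]] := h s; rewrite eqxx.
  - by apply/forallP => a; have /andP[] := h a.
rewrite card_family foldrE big_map big_enum /=.
have cardu : #|[pred w | opt w & w != u]| = #|opt|.-1.
  by rewrite (cardD1 u opt) unfold_in opt_u /=; apply: eq_card => w; rewrite !inE andbC.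
rewrite (bigD1 s) //= (_ : #|F s| = 1%N); last first.
  rewrite -(card1 u); apply: eq_card => w; rewrite !inE eqxx (negbTE Ks) /= andbT.
  by case: eqP => [->|_]; rewrite ?andbF ?andbT.
rewrite mul1n (bigID K) /=; congr muln.
  rewrite (eq_bigr (fun=> #|opt|.-1)) => [|a /andP[/negbTE nas Ka]].
    rewrite prod_nat_const; congr (_ ^ _)%N; apply: eq_card => a; rewrite !unfold_in /=.
    by case: eqP => // ->; rewrite (negbTE Ks).
  by rewrite -cardu; apply: eq_card => w; rewrite !inE nas Ka unfold_in /= andbT.
rewrite (eq_bigr (fun=> #|opt|)) => [|a /andP[/negbTE nas Ka]]; last first.
  by apply: eq_card => w; rewrite !unfold_in /= nas (negbTE Ka) /= !andbT.
rewrite prod_nat_const; congr (_ ^ _)%N.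
have <- : #|predC1 s| = #|I|.-1 by rewrite (cardC1 s).
rewrite -(cardID K (predC1 s)) (_ : #|[predI predC1 s & K]| = #|K|) ?addKn.
  by apply: eq_card => a; rewrite !inE andbC.
by apply: eq_card => a; rewrite !unfold_in /=; case: eqP => // ->; rewrite (negbTE Ks).
Qed.

(** Without the last condition every value of [z s] allows the same number of choices; the choices
    removed have [z s = o], with both [D] and [B] avoiding [o]. The sum on the left avoids truncated
    subtraction. *)
Lemma card_ffun_restricted (I U : finType) (opt : pred U) (s : I) (o : U) (D B : pred I) :
  opt o -> ~~ D s -> ~~ B s -> (forall a, D a -> ~~ B a) ->
  let Q := #|opt| in
  (#|[set z : {ffun I -> U} | [&& [forall a, opt (z a)],
        [forall a, D a ==> (z a != z s)] &
        ~~ ((z s == o) && [forall a, B a ==> (z a != o)])]]|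
   + Q.-1 ^ (#|D| + #|B|) * Q ^ (#|I|.-1 - (#|D| + #|B|)) =
   Q * (Q.-1 ^ #|D| * Q ^ (#|I|.-1 - #|D|)))%N.
Proof.
move=> opt_o Ds Bs DB Q.
have <- : #|[predU D & B]| = (#|D| + #|B|)%N.
  rewrite -cardUI [X in (_ + X)%N]eq_card0 ?addn0 // => a; rewrite !inE.
  by case Da: (a \in D) => //=; apply/negbTE/DB.
rewrite -(card_ffun_avoid (s := s) (u := o) (K := [predU D & B]) opt_o); last first.
  by rewrite /= !unfold_in negb_or Ds.
pose A := [set z : {ffun I -> U} | [forall a, opt (z a)] && [forall a, D a ==> (z a != z s)]].
transitivity #|A|; last first.
  rewrite -sum1_card (partition_big (fun z : {ffun I -> U} => z s) opt) /=; last first.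
    by move=> z; rewrite inE => /andP[/forallP h _].
  rewrite -sum_nat_const; apply: eq_bigr => u opt_u; rewrite -(card_ffun_avoid opt_u Ds) sum1_card.
  apply: eq_card => z; rewrite !inE unfold_in /= inE -!andbA; congr andb.
  rewrite andbC; case: eqP => //= e; apply: eq_forallb => a; by rewrite e.
rewrite -[RHS](cardsID [set z : {ffun I -> U} | (z s == o) && [forall a, B a ==> (z a != o)]]).
rewrite addnC; congr addn; apply: eq_card => z; rewrite !inE.
  rewrite -!andbA; congr andb; rewrite andbCA; case: eqP => //= e; rewrite e.
  apply/forallP/andP => [h|[/forallP h1 /forallP h2] a].
    split; apply/forallP => a; apply/implyP => ha; have /implyP := h a; apply.
      by rewrite /= !unfold_in ha.
    by rewrite /= !unfold_in ha orbT.
  by apply/implyP => /orP[ha|ha]; [exact: (implyP (h1 a)) | exact: (implyP (h2 a))].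
by rewrite [RHS]andbC -!andbA.
Qed.

Import GRing.Theory.
Local Open Scope ring_scope.

(** * Points of the restriction *)

Definition restricted_values (q m : nat) (s t : 'I_m) (w : 'I_m -> nat) : Prop :=
  [/\ forall k, (1 < w k < q)%N, w s = w t &
      forall k l : 'I_m, (k < l)%N ->
        (w k + w l)%N <> q /\ (w k + w l)%N <> q.+1 /\ w k <> (w l).+1 /\
        (w k = w l -> k = s /\ l = t)].

Lemma coord_formE (m : nat) (s k : 'I_m) : coord_form s 0 k = (k == s)%:Z.
Proof. by rewrite mxE eqxx natz. Qed.

Lemma sum_coord_form (q m : nat) (x : 'rV['Z_q]_m) (k : 'I_m) :
  \sum_(u < m) (coord_form k 0 u)%:~R * x 0 u = x 0 k.
Proof.
rewrite (bigD1 k) //= coord_formE eqxx mul1r big1 ?addr0 // => u ne.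
by rewrite coord_formE (negbTE ne) mul0r.
Qed.

Lemma sum_coord_formD (q m : nat) (x : 'rV['Z_q]_m) (k l : 'I_m) :
  \sum_(u < m) ((coord_form k + coord_form l) 0 u)%:~R * x 0 u = x 0 k + x 0 l.
Proof.
rewrite -!sum_coord_form -big_split; apply: eq_bigr => u _.
by rewrite mxE rmorphD /= mulrDl.
Qed.

Lemma sum_coord_formB (q m : nat) (x : 'rV['Z_q]_m) (k l : 'I_m) :
  \sum_(u < m) ((coord_form k - coord_form l) 0 u)%:~R * x 0 u = x 0 k - x 0 l.
Proof.
rewrite -(sum_coord_form x k) -(sum_coord_form x l) -sumrB; apply: eq_bigr => u _.
by rewrite !mxE rmorphB /= mulrBl.
Qed.

Lemma mem_hyperplane_coord (q m : nat) (x : 'rV['Z_q]_m) (k : 'I_m) (b : int) :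
  (x \in hyperplane_mod q (coord_form k, b)) = (x 0 k == b%:~R).
Proof. by rewrite inE sum_coord_form. Qed.

Lemma mem_hyperplane_sum (q m : nat) (x : 'rV['Z_q]_m) (k l : 'I_m) (b : int) :
  (x \in hyperplane_mod q (coord_form k + coord_form l, b)) =
  (x 0 k + x 0 l == b%:~R).
Proof. by rewrite inE sum_coord_formD. Qed.

Lemma mem_hyperplane_diff (q m : nat) (x : 'rV['Z_q]_m) (k l : 'I_m) (b : int) :
  (x \in hyperplane_mod q (coord_form k - coord_form l, b)) =
  (x 0 k - x 0 l == b%:~R).
Proof. by rewrite inE sum_coord_formB. Qed.

Lemma diff_hyperplane_inj (m : nat) (s t k l : 'I_m) : s != t ->
  diff_hyperplane k l = diff_hyperplane s t -> k = s /\ l = t.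
Proof.
move=> ne_st [/matrixP e]; have := e 0 s; have := e 0 t.
rewrite !mxE !eqxx /=.
rewrite (eq_sym t s) (negbTE ne_st).
case: (eqVneq t k) => tk; case: (eqVneq t l) => tl; case: (eqVneq s k) => sk;
  case: (eqVneq s l) => sl; try (by move/eqP); try (by move=> _ /eqP).
Qed.

Lemma restriction_compl_coordsP (q m : nat) (s t : 'I_m) (x : 'rV['Z_q]_m) : (s < t)%N ->
  reflect [/\ x 0 s = x 0 t, forall k, x 0 k <> 0 /\ x 0 k <> 1 &
    forall k l : 'I_m, (k < l)%N ->
      [/\ x 0 k + x 0 l <> 0, x 0 k + x 0 l <> 1, x 0 k - x 0 l <> 1 &
          x 0 k - x 0 l = 0 -> k = s /\ l = t]]
    (x \in restriction_compl q (shi_B m) (diff_hyperplane s t)).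
Proof.
move=> lt_st; have ne_st : s != t by rewrite neq_ltn lt_st.
pose off H' := (H' != diff_hyperplane s t) ==> (x \notin hyperplane_mod q H').
(* The restricting equation has coefficient -1 at [t] and constant term 0, which separates it from
   the three families below. *)
have not_diff_coord k b : (coord_form k, b) != diff_hyperplane s t.
  apply/eqP => -[/matrixP/(_ 0 t) + _]; rewrite !mxE !eqxx /= (eq_sym t s) (negbTE ne_st).
  by case: (t == k) => /eqP.
have not_diff_sum k l b : (coord_form k + coord_form l, b) != diff_hyperplane s t.
  apply/eqP => -[/matrixP/(_ 0 t) + _]; rewrite !mxE !eqxx /= (eq_sym t s) (negbTE ne_st).
  by case: (t == k) (t == l) => [] [] /eqP.
have not_diff_1 k l : (coord_form k - coord_form l, 1) != diff_hyperplane s t.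
  by apply/eqP => -[_ /eqP].
rewrite inE mem_hyperplane_diff subr_eq0; apply: (iffP andP).
  case=> /eqP xs; rewrite all_cat => /andP[/all_allpairsP h1 /allP h2].
  have h2' (k l : 'I_m) H' : (k < l)%N -> H' \in [:: (coord_form k + coord_form l, 0);
      (coord_form k + coord_form l, 1); diff_hyperplane k l;
      (coord_form k - coord_form l, 1)] -> off H'.
    move=> lt_kl inH; apply: h2; apply/flattenP.
    eexists; last exact: inH.
    by apply/mapP; exists (k, l) => //; rewrite mem_filter lt_kl mem_enum.
  split=> // [k|k l lt_kl].
    have h b : b \in [:: 0; 1] -> x 0 k != b%:~R.
      by move=> hb; have := h1 k b (mem_enum _ _) hb; rewrite not_diff_coord mem_hyperplane_coord.
    by split; apply/eqP; [apply: (h 0) | apply: (h 1)].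
  split.
  - have := h2' k l (coord_form k + coord_form l, 0) lt_kl; rewrite /off not_diff_sum mem_hyperplane_sum.
    by rewrite !inE eqxx => /(_ isT)/eqP.
  - have := h2' k l (coord_form k + coord_form l, 1) lt_kl; rewrite /off not_diff_sum mem_hyperplane_sum.
    by rewrite !inE eqxx ?orbT => /(_ isT)/eqP.
  - have := h2' k l (coord_form k - coord_form l, 1) lt_kl; rewrite /off not_diff_1 mem_hyperplane_diff.
    by rewrite !inE eqxx ?orbT => /(_ isT)/eqP.
  - have := h2' k l (diff_hyperplane k l) lt_kl; rewrite /off mem_hyperplane_diff.
    rewrite !inE eqxx ?orbT => /(_ isT) + e; rewrite e eqxx implybF negbK => /eqP.
    exact: diff_hyperplane_inj.
case=> xs h1 h2; split; first exact/eqP.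
rewrite all_cat; apply/andP; split.
  apply/all_allpairsP => k b _; rewrite not_diff_coord mem_hyperplane_coord /= !inE.
  by have [h0 h1'] := h1 k; case/orP => /eqP ->; apply/eqP.
apply/allP => H' /flattenP[hs /mapP[[k l]]].
rewrite mem_filter => /andP[lt_kl _] -> {hs}; have [/eqP h3 /eqP h4 /eqP h5 h6] := h2 k l lt_kl.
rewrite !in_cons in_nil orbF /= => /or4P[] /eqP ->.
- by rewrite not_diff_sum mem_hyperplane_sum.
- by rewrite not_diff_sum mem_hyperplane_sum.
- apply/implyP => /eqP ne; rewrite mem_hyperplane_diff; apply/eqP => /h6[ek el].
  by apply: ne; rewrite ek el.
- by rewrite not_diff_1 mem_hyperplane_diff.
Qed.

Lemma restriction_compl_valuesP (q m : nat) (s t : 'I_m) (x : 'rV['Z_q]_m) :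
  (1 < q)%N -> (s < t)%N ->
  x \in restriction_compl q (shi_B m) (diff_hyperplane s t) <->
  restricted_values q s t (fun k => x 0 k : nat).
Proof.
case: q x => [//|[//|q]] x _ lt_st.
have val0 (u : 'Z_q.+2) : u = 0 <-> u = 0%N :> nat.
  by split=> [->//|h]; apply: val_inj.
have val1 (u : 'Z_q.+2) : u = 1 <-> u = 1%N :> nat.
  by split=> [->//|h]; apply: val_inj.
have ltq (u : 'Z_q.+2) : (u < q.+2)%N by exact: ltn_ord.
(* Representatives are below the modulus, so a sum wraps around at most once. *)
have D0 (u w : 'Z_q.+2) : u + w = 0 <-> (u + w = 0 \/ u + w = q.+2)%N.
  have := ltq u; have := ltq w; rewrite val0 /= => hw hu.
  case: (ltnP (u + w) q.+2) => h; first by rewrite modn_small //; lia.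
  by rewrite -{1}(subnK h) modnDr modn_small; lia.
have D1 (u w : 'Z_q.+2) : u + w = 1 <-> (u + w = 1 \/ u + w = q.+3)%N.
  have := ltq u; have := ltq w; rewrite val1 /= => hw hu.
  case: (ltnP (u + w) q.+2) => h; first by rewrite modn_small //; lia.
  by rewrite -{1}(subnK h) modnDr modn_small; lia.
have B0 (u w : 'Z_q.+2) : u - w = 0 <-> u = w :> nat.
  by split=> [/eqP|/val_inj ->]; rewrite ?subrr // subr_eq0 => /eqP ->.
have B1 (u w : 'Z_q.+2) : u - w = 1 <->
    (u : nat) = (w + 1)%N \/ (u : nat) = 0%N /\ (w : nat) = q.+1.
  have -> : u - w = 1 <-> u = w + 1.
    by split=> [<-|->]; [rewrite addrC subrK | rewrite addrC addKr].
  have -> : u = w + 1 <-> (u : nat) = ((w + 1) %% q.+2)%N.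
    by split=> [->|h]; [rewrite /= modnS | apply: val_inj].
  have := ltq u; have := ltq w => hw hu.
  case: (ltnP (w + 1) q.+2) => h; first by rewrite modn_small //; lia.
  by rewrite -{1}(subnK h) modnDr modn_small; lia.
split.
  case/(restriction_compl_coordsP _ lt_st) => xs h1 h2.
  have bnd k : (1 < x 0%R k < q.+2)%N.
    by have [+ +] := h1 k; rewrite val0 val1; have := ltq (x 0%R k); lia.
  split=> // [|k l lt_kl]; first by rewrite xs.
  have [] := h2 k l lt_kl; rewrite D0 D1 B0 B1 => h3 h4 h5 h6.
  by have := bnd k; have := bnd l; split; [lia | split; [lia | split=> //; lia]].
case=> bnd /val_inj xs h; apply/restriction_compl_coordsP => //; split=> // [k|k l lt_kl].
  by rewrite val0 val1; have := bnd k; lia.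
have := h k l lt_kl; have := bnd k; have := bnd l.
move=> bl bk [h3 [h4 [h5 h6]]].
by split; [rewrite D0; lia | rewrite D1; lia | rewrite B1; lia | rewrite B0].
Qed.

(** * Merging the two equal coordinates *)

Lemma lift_cases (n : nat) (t : 'I_n.+1) (a : 'I_n) :
  ((t <= a /\ lift t a = a.+1 :> nat) \/ (a < t /\ lift t a = a :> nat))%N.
Proof. by rewrite /= /bump; case: leqP; [left | right]. Qed.

(* [unliftP] at the type ['I_n] instead of ['I_(n.+1.-1)], which [lia] tells apart. *)
Lemma lift_or_eq (n : nat) (t u : 'I_n.+1) : (exists a : 'I_n, u = lift t a) \/ u = t.
Proof. by case: (unliftP t u) => [a ->|->]; [left; exists a | right]. Qed.

Lemma values_of_restricted (q n : nat) (s : 'I_n) (t : 'I_n.+1) (w : 'I_n.+1 -> nat) :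
  (s < t)%N -> restricted_values q (lift t s) t w ->
  admissible_values q s t (fun a => w (lift t a)).
Proof.
move=> lt_st [w_in w_st w_ne];
have lt_sst : (lift t s < t)%N by have := lift_cases t s; lia.
split=> [a|a c lt_ac|e|e|a s_a e]; first exact: w_in.
- have [|h1 [h2 [h3 h4]]] := w_ne (lift t a) (lift t c); first by have := lift_cases t a; have := lift_cases t c; lia.
  split; last by [].
  by move=> /h4[_ /esym/eqP]; rewrite (negbTE (neq_lift _ _)).
- by have [] := w_ne _ _ lt_sst; rewrite -w_st addnn.
- by have [_ []] := w_ne _ _ lt_sst; rewrite -w_st addnn.
- have [|_ [_ [/eqP h _]]] := w_ne (lift t a) t; first by have := lift_cases t a; lia.
  by move: h; rewrite e w_st eqxx.
Qed.

(** The default [s] hands the value of the merged label to [t]; a pair involving [t] is then settled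
    by the matching pair involving [s], with [v_btw] when the other label lies in between. *)
Lemma restricted_of_values (q n : nat) (s : 'I_n) (t : 'I_n.+1) (v : 'I_n -> nat) :
  (s < t)%N -> admissible_values q s t v ->
  restricted_values q (lift t s) t (fun k => v (odflt s (unlift t k))).
Proof.
move=> lt_st [v_in v_ne s0 s1 v_btw].
split=> [k||k l]; [exact: v_in | by rewrite liftK unlift_none |].
case: (lift_or_eq t k) => [[a ->]|->]; case: (lift_or_eq t l) => [[c ->]|->] lt;
  rewrite ?liftK ?unlift_none /=.
- have [|h1 [h2 [h3 h4]]] := v_ne a c; first by have := lift_cases t a; have := lift_cases t c; lia.
  by do 3?split.
- have [eas|ne] := eqVneq a s; first by rewrite eas addnn; do 3?split=> //; lia.
  have ne' : a <> s :> nat by move/val_inj/eqP; rewrite (negbTE ne).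
  have := v_ne a s; have := v_ne s a; have := v_btw a; have := lift_cases t a => h1 h2 h3 h4.
  have ne_v : v a <> v s by lia.
  by split; [lia | split; [lia | split; [lia | move/ne_v]]].
- have := lift_cases t c => h; have := v_ne s c => h'.
  have ne_v : v s <> v c by lia.
  by split; [lia | split; [lia | split; [lia | move/ne_v]]].
- lia.
Qed.

Lemma eq_card_in_can (X Z : finType) (A : {set X}) (B : {set Z}) (f : X -> Z) (g : Z -> X) :
  (forall x, x \in A -> f x \in B /\ g (f x) = x) ->
  (forall z, z \in B -> g z \in A /\ f (g z) = z) -> #|A| = #|B|.
Proof.
move=> fP gP; apply/eqP; rewrite eqn_leq; apply/andP; split.
  rewrite -(card_in_imset (f := f) (D := A)); last first.
    by move=> x y /fP[_ {2}<-] /fP[_ {2}<-] ->.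
  by apply/subset_leq_card/subsetP => _ /imsetP[x /fP[fx _] ->].
rewrite -(card_in_imset (f := g) (D := B)); last first.
  by move=> x y /gP[_ {2}<-] /gP[_ {2}<-] ->.
by apply/subset_leq_card/subsetP => _ /imsetP[x /gP[fx _] ->].
Qed.

(* A run starting next to 0 has no positive label, and for even [q] the run
   ending at [q / 2] has no negative one. *)
Definition block_option (odd_q : bool) (E : nat) : pred (bool * 'I_E.+1) :=
  fun u => ((val u.2 == 0) ==> u.1) && ((~~ odd_q && (val u.2 == E)) ==> ~~ u.1).

(** These labels come after [s] in the last run when they and [s] choose [(odd_q, ord_max)]:
    negative labels decrease there and positive ones increase. *)
Definition later_label (odd_q : bool) (n : nat) (s : 'I_n) (t : nat) : pred 'I_n :=
  fun a => if odd_q then (a < s)%N else (t <= a < n)%N.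

Definition block_choices (odd_q : bool) (E n : nat) (s : 'I_n) (t : nat) :
    {set {ffun 'I_n -> bool * 'I_E.+1}} :=
  [set z : {ffun 'I_n -> bool * 'I_E.+1} | [&& [forall a, block_option odd_q (z a)],
        [forall a : 'I_n, (s < a < t)%N ==> (z a != z s)] &
        ~~ ((z s == (odd_q, ord_max)) &&
            [forall a, later_label odd_q s t a ==> (z a != (odd_q, ord_max))])]].

Lemma block_choicesP (odd_q : bool) (E n : nat) (s : 'I_n) (t : nat)
    (z : {ffun 'I_n -> bool * 'I_E.+1}) :
  z \in block_choices odd_q E s t <->
  admissible_blocks odd_q E s t (fun a => (z a).1) (fun a => val (z a).2).
Proof.
rewrite inE.
have last_eq a : (z a == (odd_q, ord_max)) = ((z a).1 == odd_q) && (val (z a).2 == E).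
  by rewrite -pair_eqE /= -val_eqE.
rewrite last_eq; split.
  case/and3P => /forallP opt /forallP btw lst; split=> [a|a a0|a s_a e1 e2|].
  - by rewrite -ltnS ltn_ord.
  - by have /andP[/implyP h _] := opt a; apply/h/eqP.
  - have /implyP/(_ s_a)/eqP := btw a; apply.
    by move: e1 e2; case: (z a) (z s) => [x1 x2] [y1 y2] /= -> /val_inj ->.
  - move: lst opt last_eq; rewrite /block_option /later_label.
    case: odd_q => /= /negP lst opt last_eq; last split=> [a ba|[bs no]].
    + move=> [sgs bs no]; apply: lst; rewrite sgs bs !eqxx /=.
      apply/forallP => a; apply/implyP => lt_as; rewrite last_eq eqb_id.
      by apply/negP => /andP[/(no a lt_as) h /eqP].
    + by have /andP[_ /implyP h] := opt a; apply/h/eqP.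
    + apply: lst; have /andP[_] := opt s; rewrite bs !eqxx andbT /= => /negbTE ->.
      apply/forallP => a; apply/implyP => /andP[le_ta _]; rewrite last_eq.
      by apply/negP => /andP[_ /eqP]; exact: no.
case=> b_le b0 btw lst; apply/and3P; split.
- apply/forallP => a; apply/andP; split; first by apply/implyP => /eqP/b0.
  by case: odd_q lst {last_eq} => //= -[h _]; apply/implyP => /eqP/h.
- apply/forallP => a; apply/implyP => s_a; apply/eqP => e.
  by apply: (btw a s_a); rewrite e.
- apply/negP => /andP[/andP[/eqP sgs /eqP bs] /forallP no].
  move: lst last_eq no sgs; rewrite /later_label.
  case: odd_q => [lst|[pos lst]] last_eq no sgs; apply: lst; split=> //.
    move=> a lt_as sga ba; have /implyP/(_ lt_as) := no a.
    by rewrite last_eq sga ba !eqxx.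
  move=> a le_ta ba; have := no a; rewrite le_ta ltn_ord last_eq ba eqxx andbT /=.
  by rewrite (negbTE (pos a ba)).
Qed.

(** * Number of block choices *)

Lemma card_window_full (T : finType) (p : T -> nat) (lo hi : nat) :
  injective p -> (forall c, p c < #|T|)%N -> (lo <= hi <= #|T|)%N ->
  #|[pred c | (lo <= p c < hi)%N]| = (hi - lo)%N.
Proof.
move=> injp ltp h; have e : #|T| = #|[pred c | (0 <= p c < #|T|)%N]|.
  by apply: eq_card => c; rewrite !inE ltp.
rewrite (window_split (mid := lo) p (lo := 0%N)) in e; last by lia.
rewrite (window_split (mid := hi) p (lo := lo)) in e; last by lia.
have := card_window 0%N lo injp; have := card_window lo hi injp.
have := card_window hi #|T| injp; lia.
Qed.

Lemma card_ord_interval (n lo hi : nat) : (lo <= hi <= n)%N ->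
  #|[pred a : 'I_n | (lo <= a < hi)%N]| = (hi - lo)%N.
Proof.
move=> h; apply: (card_window_full (p := @nat_of_ord n)); rewrite ?card_ord //.
exact: val_inj.
Qed.

(** Of the [2 * E.+1] pairs, one is lost next to 0 and, for even [q], another at the far end. *)
Lemma card_block_option (odd_q : bool) (E : nat) :
  #|block_option odd_q (E := E)| = (2 * E + odd_q)%N.
Proof.
pose bad : pred (bool * 'I_E.+1) := if odd_q then pred1 (false, ord0)
  else pred2 (false, ord0) (true, ord_max).
have card_bad : #|bad| = (2 - odd_q)%N.
  by rewrite /bad; case: (odd_q); rewrite ?card1 ?card2 // xpair_eqE.
rewrite (eq_card (B := predC bad)).
  apply/eqP; rewrite -(eqn_add2l #|bad|) cardC card_bad card_prod card_bool card_ord.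
  by case: (odd_q); lia.
move=> [x y]; rewrite -[LHS]/(block_option odd_q (x, y)) -[RHS]/(~~ bad (x, y)).
rewrite /block_option /bad; case: (odd_q); case: x; rewrite /= ?xpair_eqE -?val_eqE /=.
all: by rewrite ?implybT ?andbT ?orbF ?implybF.
Qed.

Lemma card_block_choices (odd_q : bool) (E n : nat) (s : 'I_n) (t : nat) :
  (0 < E)%N -> (s < t <= n)%N ->
  let Q := (2 * E + odd_q)%N in
  let B := (if odd_q then s : nat else n - t)%N in
  (#|block_choices odd_q E s t| +
   Q.-1 ^ (t - s.+1 + B) * Q ^ (n.-1 - (t - s.+1 + B)) =
   Q * (Q.-1 ^ (t - s.+1) * Q ^ (n.-1 - (t - s.+1))))%N.
Proof.
move=> E0 lt_st Q B; pose D : pred 'I_n := fun a => (s < a < t)%N.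
have cD : #|D| = (t - s.+1)%N.
  by rewrite -(@card_ord_interval n); [apply: eq_card | lia].
have cB : #|later_label odd_q s t| = B.
  rewrite /B; case: (odd_q); last by rewrite -(@card_ord_interval n); [apply: eq_card | lia].
  by rewrite -[RHS]subn0 -(@card_ord_interval n); [apply: eq_card | have := ltn_ord s; lia].
have := @card_ffun_restricted 'I_n _ (@block_option odd_q E) s (odd_q, ord_max)
    D (later_label odd_q s t).
rewrite cD cB card_ord (card_block_option odd_q E); apply.
(* For even [q] the option [(false, ord_max)] is legal because [0 < E] separates block [E] from
   block 0. *)
- by rewrite /block_option /=; case: (odd_q); rewrite /= ?implybT ?implybF ?andbT -?lt0n.
- by rewrite /D ltnn.
- by rewrite /later_label; case: (odd_q); rewrite ?ltnn //; lia.
- by rewrite /D /later_label => a; case: (odd_q); lia.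
Qed.

(** * The bijection and the final count *)

(** Composite of three correspondences: coordinates with values after merging, values with signed
    places, places with blocks. *)
Lemma card_restriction_compl_blocks (q n : nat) (s : 'I_n) (t : 'I_n.+1) :
  (1 < q)%N -> (n < q./2)%N -> (s < t)%N ->
  #|restriction_compl q (shi_B n.+1) (diff_hyperplane (lift t s) t)| =
  #|block_choices (odd q) (q./2 - n) s t|.
Proof.
move=> lt1q lt_nq lt_st; set E := (q./2 - n)%N.
have lt_sst : (lift t s < t)%N by have := lift_cases t s; lia.
pose vals (x : 'rV['Z_q]_n.+1) : 'I_n -> nat := fun a => x 0 (lift t a).
pose sgn (v : 'I_n -> nat) : 'I_n -> bool := fun a => (q < (v a).*2)%N.
pose pos (v : 'I_n -> nat) : 'I_n -> nat :=
  fun a => ((if q < (v a).*2 then q - v a else v a).-1)%N.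
pose val_of (sg : 'I_n -> bool) (p : 'I_n -> nat) : 'I_n -> nat :=
  fun a => (if sg a then q - (p a).+1 else (p a).+1)%N.
pose sg_of (z : {ffun 'I_n -> bool * 'I_E.+1}) : 'I_n -> bool := fun a => (z a).1.
pose b_of (z : {ffun 'I_n -> bool * 'I_E.+1}) : 'I_n -> nat := fun a => val (z a).2.
(* On points of the restriction [inord] never falls back to its default, since blocks are at most
   [E]. *)
pose f (x : 'rV['Z_q]_n.+1) := [ffun a => (sgn (vals x) a,
  inord (block (pos (vals x)) a) : 'I_E.+1)].
pose v_of z := val_of (sg_of z) (block_pos (b_of z) (signed_lt (sg_of z))).
pose g z : 'rV['Z_q]_n.+1 := \row_k (v_of z (odflt s (unlift t k)))%:R.
apply: (eq_card_in_can (f := f) (g := g)) => [x|z].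
  move/(restriction_compl_valuesP _ lt1q lt_sst) => hw.
  have hv : admissible_values q s t (vals x) by exact: values_of_restricted lt_st hw.
  have hp : admissible_positions q s t (sgn (vals x)) (pos (vals x)).
    exact: positions_of_values.
  have hb := blocks_of_positions (ltnW lt_nq) hp.
  have sgE : sg_of (f x) = sgn (vals x).
    by apply: functional_extensionality => a; rewrite /sg_of ffunE.
  have bE : b_of (f x) = block (pos (vals x)).
    apply: functional_extensionality => a; rewrite /b_of ffunE /= inordK //.
    by rewrite ltnS; case: hb.
  split; first by apply/block_choicesP; rewrite // -/(sg_of (f x)) -/(b_of (f x)) sgE bE.
  have vE a : v_of (f x) a = vals x a.
    rewrite /v_of /val_of sgE bE; case: hp => _ injp p_succ _ _.
    rewrite (blockK a injp (@run_rel_trans _ s t _) p_succ).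
    - by apply: positions_of_valuesK; case: hv.
    - by move=> u w /andP[].
    - exact: signed_lt_asym.
  apply/rowP => k; rewrite mxE vE /vals natr_Zp; case: hw => _ w_st _.
  by case: unliftP => [a ->|->] //=; apply: val_inj.
move/block_choicesP => hb.
have hp := positions_of_blocks lt_nq lt_st hb.
have hv := values_of_positions hp.
have hw := restricted_of_values lt_st hv.
have gE k : (g z 0 k : nat) = v_of z (odflt s (unlift t k)).
  rewrite mxE val_Zp_nat // modn_small //.
  by case: hw => /(_ k)/andP[].
have valsE : vals (g z) = v_of z.
  by apply: functional_extensionality => a; rewrite /vals gE liftK.
split.
  apply/(restriction_compl_valuesP _ lt1q lt_sst).
  by rewrite (functional_extensionality _ _ gE).
have posK a := values_of_positionsK a hp.
have sgE a : sgn (v_of z) a = (z a).1 by case: (posK a).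
have pE : pos (v_of z) = block_pos (b_of z) (signed_lt (sg_of z)).
  by apply: functional_extensionality => a; case: (posK a); rewrite /pos => -> <-.
apply/ffunP => a; rewrite ffunE valsE sgE pE block_posK.
- by rewrite /b_of inord_val -surjective_pairing.
- exact: signed_lt_trans.
- exact: signed_lt_irr.
- exact: signed_lt_total.
Qed.

Theorem theorem5p1 (m : nat) (s t : 'I_m) (hst : (s < t)%N) :
  let i := s.+1 in
  let j := t.+1 in
  exists N : nat, forall q : nat, (1 < q)%N -> (N <= q)%N ->
    (#|restriction_compl q (shi_B m) (diff_hyperplane s t)|)%:Z =
    (if odd q then
       (q%:Z - (2 * m)%:Z + 1) ^+ (j - i - 1) *
       (q%:Z - (2 * m)%:Z + 2) ^+ (m - j) *
       ((q%:Z - (2 * m)%:Z + 2) ^+ i - (q%:Z - (2 * m)%:Z + 1) ^+ (i - 1))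
     else
       (q%:Z - (2 * m)%:Z + 1) ^+ (j - i - 1) *
       (q%:Z - (2 * m)%:Z + 2) ^+ (i - 1) *
       ((q%:Z - (2 * m)%:Z + 2) ^+ (m - j + 1)
        - (q%:Z - (2 * m)%:Z + 1) ^+ (m - j))).
Proof.
case: m s t hst => [|n] s t hst; first by case: (s).
have [[a sa]|st] := lift_or_eq t s; last by rewrite st ltnn in hst.
rewrite sa in hst * => i j.
(* With m = n + 1 this bound gives [n < q./2], so at least one place stays free. *)
exists (2 * n.+2)%N => q lt1q leNq.
have lt_at : (a < t)%N by have := lift_cases t a; lia.
have sE : lift t a = a :> nat by have := lift_cases t a; lia.
have qE := odd_double_half q.
have lt_nq : (n < q./2)%N by move: leNq; rewrite -qE; case: (odd q); lia.
rewrite (card_restriction_compl_blocks lt1q lt_nq lt_at).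
have E0 : (0 < q./2 - n)%N by rewrite subn_gt0.
have t_n : (a < t <= n)%N by have := ltn_ord t; lia.
have cX := card_block_choices (odd q) E0 t_n.
(* This is q - 2n = q - 2m + 2, the number of options of a label. *)
pose Q := (2 * (q./2 - n) + odd q)%N.
have Qz : q%:Z - (2 * n.+1)%:Z + 2 = Q%:Z by clear cX; rewrite /Q -{1}qE; case: (odd q); lia.
have Pz : q%:Z - (2 * n.+1)%:Z + 1 = Q.-1%:Z.
  by clear cX Qz; rewrite /Q -{1}qE; case: (odd q); lia.
move: cX; rewrite -/Q /= Qz Pz /i /j sE; clearbody Q.
have -> : (t.+1 - a.+1 - 1 = t - a.+1)%N by rewrite subSS subn1 subnS.
(* The unrestricted labels are the [a] labels below the merged one and the [n - t] labels from [t]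
   on. *)
have -> : (n.-1 - (t - a.+1) = a + (n - t))%N by clear Qz Pz; lia.
rewrite subSS subn1 addn1 => cX.
(* In the integers the added term can move to the other side as the subtracted power. *)
have /= := congr1 (fun k => k%:R : int) cX.
case: (odd q).
  have -> : (n.-1 - (t - a.+1 + a) = n - t)%N by clear -t_n; lia.
  by rewrite !(natrD, natrM, natrX) !natz !exprD !exprS => /(canRL (addrK _)) ->; ring.
have -> : (n.-1 - (t - a.+1 + (n - t)) = a)%N by clear -t_n; lia.
by rewrite !(natrD, natrM, natrX) !natz !exprD !exprS => /(canRL (addrK _)) ->; ring.
Qed.
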